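(* Let $M$ be a simple matroid of rank $\ell$ on $[n]$, let $I=I(M)\subset E$ be its Orlik–Solomon ideal, and let $Z=\{z(T)\mid T\in\mathbf{nbc}_\ell\}$. Then $Z$ is a Gröbner basis of the annihilator ideal $I^0$ with respect to the degree-lexicographic monomial ordering; that is, $Z\subset I^0$ and $\mathrm{In}(I^0)=\langle \mathrm{In}(Z)\rangle$.
   Context: $R$ is an arbitrary nonzero commutative ring with $1$. $M$ is a simple matroid (no loops, no nontrivial parallel classes) on $[n]=\{1,\dots,n\}$ of rank $\ell$. $E$ is the exterior algebra over $R$ on the free $R$-module with basis $e_1,\dots,e_n$, with the standard grading $E_p=\Lambda^p$. For $S=\{i_1<\dots<i_p\}\subset[n]$ put $e_S=e_{i_1}\cdots e_{i_p}$ ($e_\emptyset=1$). $\partial:E\to E$ is the $R$-linear map of degree $-1$ with $\partial e_i=1$ for all $i$ and $\partial(ab)=(\partial a)b+(-1)^{\deg a}a\,\partial b$ for homogeneous $a$ and all $b$. The Orlik–Solomon ideal $I=I(M)$ is the ideal of $E$ generated by $\partial e_S$ for all dependent sets $S$ of $M$. The annihilator is $I^0=\{a\in E\mid ab=0\text{ for every }b\in I\}$. A broken circuit is a circuit of $M$ with its smallest element deleted. A subset of $[n]$ is $\mathbf{nbc}$ if it contains no broken circuit; $\mathbf{nbc}_p$ is the set of $\mathbf{nbc}$-sets of cardinality $p$. $cl$ is the closure operator of $M$. Definition of $z(T)$ for $T=\{i_1<\dots<i_\ell\}\in\mathbf{nbc}_\ell$: put $X_0=\emptyset$, $X_p=cl(\{i_{\ell-p+1},\dots,i_\ell\})$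 and $S_p=X_p\setminus X_{p-1}$ for $1\le p\le \ell$. Then $S_1,\dots,S_\ell$ partition $[n]$ and $$z(T)=\mathrm{sign}(\sigma)\,\partial(e_{S_1})\partial(e_{S_2})\cdots\partial(e_{S_\ell}),$$ where $\sigma$ is the permutation of $[n]$ listing the elements of $S_1$ in increasing order, then those of $S_2$ in increasing order, and so on. Monomials of $E$ are the $e_S$, $S\subset[n]$. Degree-lexicographic order: $e_S<e_{S'}$ if $|S|<|S'|$, or $|S|=|S'|$ and the increasing sequence of elements of $S$ is lexicographically smaller than that of $S'$. For $A\subset E$, $\mathrm{In}(A)$ is the set of leading monomials (i.e. maximal monomials occurring with nonzero coefficient) of nonzero elements of $A$, and $\langle \mathrm{In}(Z)\rangle$ is the set of all monomials divisible by some monomial in $\mathrm{In}(Z)$. *)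

(* Defs.v *)
From HB Require Import structures.
From mathcomp Require Import all_boot all_order all_fingroup all_algebra.

Set Implicit Arguments.
Unset Strict Implicit.
Unset Printing Implicit Defensive.

Import GRing.Theory.
Local Open Scope ring_scope.

(* The ground set [n] = {1, ..., n} is 'I_n = {0, ..., n-1} with its usual    *)
(* order, and {i_1 < ... < i_p} is the sequence enum S, which is increasing.  *)

Lemma sorted_enum_ord n (S : {set 'I_n}) :
  sorted ltn [seq val i | i <- enum S].
Proof.
have -> : [seq val i | i <- enum S]
        = [seq k <- iota 0 n | k \in [seq val i | i <- enum S]].
  rewrite -val_enum_ord filter_map /=; congr map.
  rewrite {1}/enum_mem -enumT; apply: eq_filter => i /=.
  by rewrite (mem_map val_inj) mem_enum.
by apply: sorted_filter; [exact: ltn_trans | exact: iota_ltn_sorted].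
Qed.

(* The exterior algebra of a free module with basis e_1, ..., e_n: an element *)
(* a is a family of coefficients, a S being the coefficient of e_S.           *)

Definition extalg (R : comNzRingType) (n : nat) : Type :=
  {ffun {set 'I_n} -> R}.

Section ExteriorAlgebra.
Variables (R : comNzRingType) (n : nat).
Local Notation E := (extalg R n).
Implicit Types (S T U : {set 'I_n}) (a b c : E) (i j : 'I_n).

HB.instance Definition _ :=
  GRing.Lmodule.copy E {ffun {set 'I_n} -> R^o}.

Definition emono S : E := [ffun T => (T == S)%:R].

Definition egen i : E := emono [set i].

(* Number of adjacent transpositions needed to sort the word e_S e_T, for     *)
(* disjoint S and T.                                                          *)
Definition ninv S T : nat := (\sum_(i in S) \sum_(j in T) (j < i))%N.

Definition emono_mul S T : E :=
  if [disjoint S & T] then (-1) ^+ ninv S T *: emono (S :|: T) else 0.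

Definition ext_mul a b : E := \sum_S \sum_T (a S * b T) *: emono_mul S T.

Lemma ext_expand a : a = \sum_S a S *: emono S.
Proof.
apply/ffunP=> U; rewrite sum_ffunE (bigD1 U) //= !ffunE eqxx.
rewrite big1 ?addr0 => [|S neSU]; first by rewrite /GRing.scale /= mulr1.
by rewrite !ffunE eq_sym (negPf neSU) scaler0.
Qed.

Fact ext_mulDl : left_distributive ext_mul +%R.
Proof.
move=> a b c; rewrite /ext_mul -big_split; apply: eq_bigr => S _ /=.
by rewrite -big_split; apply: eq_bigr => T _ /=; rewrite ffunE mulrDl scalerDl.
Qed.

Fact ext_mulDr : right_distributive ext_mul +%R.
Proof.
move=> a b c; rewrite /ext_mul -big_split; apply: eq_bigr => S _ /=.
by rewrite -big_split; apply: eq_bigr => T _ /=; rewrite ffunE mulrDr scalerDl.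
Qed.

Fact ext_mulZl (k : R) a b : ext_mul (k *: a) b = k *: ext_mul a b.
Proof.
rewrite /ext_mul scaler_sumr; apply: eq_bigr => S _.
rewrite scaler_sumr; apply: eq_bigr => T _.
by rewrite ffunE scalerA mulrA.
Qed.

Fact ext_mulZr (k : R) a b : ext_mul a (k *: b) = k *: ext_mul a b.
Proof.
rewrite /ext_mul scaler_sumr; apply: eq_bigr => S _.
rewrite scaler_sumr; apply: eq_bigr => T _.
by rewrite ffunE scalerA mulrCA.
Qed.

Fact ext_mul0l b : ext_mul 0 b = 0.
Proof. by have := ext_mulZl 0 0 b; rewrite !scale0r. Qed.

Fact ext_mul0r a : ext_mul a 0 = 0.
Proof. by have := ext_mulZr 0 a 0; rewrite !scale0r. Qed.

Fact ext_mul_mono S T : ext_mul (emono S) (emono T) = emono_mul S T.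
Proof.
rewrite /ext_mul (bigD1 S) //= [X in _ + X]big1 => [|U neUS]; last first.
  by rewrite big1 // => V _; rewrite !ffunE (negPf neUS) mul0r scale0r.
rewrite (bigD1 T) //= [X in _ + X + _]big1 => [|U neUT]; last first.
  by rewrite !ffunE (negPf neUT) mulr0 scale0r.
by rewrite !ffunE !eqxx mulr1 scale1r !addr0.
Qed.

Lemma ninv0l T : ninv set0 T = 0%N.
Proof. by rewrite /ninv big_set0. Qed.

Lemma ninv0r S : ninv S set0 = 0%N.
Proof. by rewrite /ninv big1 // => i _; rewrite big_set0. Qed.

Lemma ninvUl S T U : [disjoint S & T] ->
  ninv (S :|: T) U = (ninv S U + ninv T U)%N.
Proof.
by move=> dST; rewrite /ninv -bigU //; apply: eq_bigl => i; rewrite !inE.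
Qed.

Lemma ninvUr S T U : [disjoint T & U] ->
  ninv S (T :|: U) = (ninv S T + ninv S U)%N.
Proof.
move=> dTU; rewrite /ninv -big_split; apply: eq_bigr => i _.
by rewrite -bigU //; apply: eq_bigl => j; rewrite !inE.
Qed.

Fact emono_mulA S T U :
  ext_mul (emono S) (emono_mul T U) = ext_mul (emono_mul S T) (emono U).
Proof.
rewrite /emono_mul; case: ifP => dTU; case: ifP => dST.
- rewrite ext_mulZl ext_mulZr !ext_mul_mono /emono_mul.
  rewrite -![[disjoint _ & _]]setI_eq0 setIUr setIUl !setU_eq0 !setI_eq0 dTU dST.
  rewrite andbT /=; case: ifP => dSU; last by rewrite !scaler0.
  rewrite !scalerA -!exprD setUA ninvUl // ninvUr //.
  by congr (_ ^+ _ *: _); rewrite addnC -addnA.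
- rewrite ext_mul0l ext_mulZr ext_mul_mono /emono_mul.
  by rewrite -setI_eq0 setIUr setU_eq0 setI_eq0 dST scaler0.
- rewrite ext_mul0r ext_mulZl ext_mul_mono /emono_mul.
  by rewrite -setI_eq0 setIUl setU_eq0 !setI_eq0 dTU andbF scaler0.
- by rewrite ext_mul0l ext_mul0r.
Qed.

Fact ext_mulA : associative ext_mul.
Proof.
move=> a b c; rewrite (ext_expand a).
elim/big_ind: _ => [|x y Hx Hy|S _]; first by rewrite !ext_mul0l.
  by rewrite !ext_mulDl Hx Hy.
rewrite !ext_mulZl (ext_expand b); congr (_ *: _).
elim/big_ind: _ => [|x y Hx Hy|T _]; first by rewrite !(ext_mul0l, ext_mul0r).
  by rewrite !(ext_mulDl, ext_mulDr) Hx Hy.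
rewrite !(ext_mulZl, ext_mulZr) (ext_expand c); congr (_ *: _).
elim/big_ind: _ => [|x y Hx Hy|U _]; first by rewrite !ext_mul0r.
  by rewrite !ext_mulDr Hx Hy.
by rewrite !ext_mulZr !ext_mul_mono emono_mulA.
Qed.

Fact ext_mul1l : left_id (emono set0) ext_mul.
Proof.
move=> a; rewrite (ext_expand a).
elim/big_ind: _ => [|x y Hx Hy|S _]; first by rewrite ext_mul0r.
  by rewrite ext_mulDr Hx Hy.
rewrite ext_mulZr ext_mul_mono /emono_mul.
by rewrite -setI_eq0 set0I eqxx ninv0l scale1r set0U.
Qed.

Fact ext_mul1r : right_id (emono set0) ext_mul.
Proof.
move=> a; rewrite (ext_expand a).
elim/big_ind: _ => [|x y Hx Hy|S _]; first by rewrite ext_mul0l.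
  by rewrite ext_mulDl Hx Hy.
rewrite ext_mulZl ext_mul_mono /emono_mul.
by rewrite -setI_eq0 setI0 eqxx ninv0r scale1r setU0.
Qed.

Fact emono_neq0 S : emono S != 0.
Proof.
by apply/eqP => /ffunP/(_ S)/eqP; rewrite !ffunE eqxx oner_eq0.
Qed.

HB.instance Definition _ := GRing.Zmodule_isNzRing.Build E
  ext_mulA ext_mul1l ext_mul1r ext_mulDl ext_mulDr (emono_neq0 set0).

HB.instance Definition _ := GRing.Lmodule_isLalgebra.Build R E
  (fun k a b => esym (ext_mulZl k a b)).

HB.instance Definition _ := GRing.Lalgebra_isAlgebra.Build R E
  (fun k a b => esym (ext_mulZr k a b)).

Lemma emono0 : emono set0 = 1.
Proof. by []. Qed.

Lemma emonoM S T : emono S * emono T =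
  if [disjoint S & T] then (-1) ^+ ninv S T *: emono (S :|: T) else 0.
Proof. exact: ext_mul_mono. Qed.

Lemma ninv1 i T : ninv [set i] T = #|[set j in T | (j < i)%N]|.
Proof.
rewrite /ninv big_set1 -sum1_card big_mkcond [RHS]big_mkcond.
by apply: eq_bigr => j _; rewrite inE; case: (j \in T); case: (j < i)%N.
Qed.

Lemma egen_sq i : egen i * egen i = 0.
Proof. by rewrite emonoM disjoints1 inE eqxx. Qed.

Lemma egenC i j : egen i * egen j = - (egen j * egen i).
Proof.
have [->|neij] := eqVneq i j; first by rewrite egen_sq oppr0.
rewrite !emonoM !disjoints1 !inE [j == i]eq_sym (negPf neij) /= setUC.
rewrite /ninv !big_set1 -scaleNr; congr (_ *: _).
case: (ltngtP i j) => [//|//|/val_inj/eqP]; last by rewrite (negPf neij).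
  by rewrite expr1 opprK.
Qed.

Lemma egen_mono i T : (forall j, j \in T -> (i < j)%N) ->
  egen i * emono T = emono (i |: T).
Proof.
move=> ltiT; rewrite emonoM disjoints1 ninv1.
have -> : i \notin T by apply/negP => /ltiT; rewrite ltnn.
rewrite (_ : [set j in T | _] = set0) ?cards0 ?scale1r //.
apply/setP => j; rewrite !inE; apply/negP => /andP[/ltiT ltij].
by rewrite ltnNge ltnW.
Qed.

Lemma emonoE S : emono S = \prod_(i <- enum S) egen i.
Proof.
rewrite -{1}[S]set_enum; elim: (enum S) (sorted_enum_ord S) => [_|i s IHs].
  by rewrite big_nil (_ : [set x in [::]] = set0) //; apply/setP=> x; rewrite !inE.
rewrite /= (path_sortedE ltn_trans) => /andP[/allP lti srt].
rewrite big_cons -IHs // egen_mono ?set_cons // => j.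
by rewrite inE => js; apply: lti; rewrite map_f.
Qed.

Definition homog (p : nat) a : Prop := forall S, a S != 0 -> #|S| = p.

(* The derivation with eder e_i = 1 for all i; see eder_gen, ederM.           *)
Definition eder a : E := \sum_S a S *:
  \sum_(i in S) (-1) ^+ #|[set j in S | (j < i)%N]| *: emono (S :\ i).

Fact eder_is_linear : linear eder.
Proof.
move=> k a b; rewrite /eder scaler_sumr -big_split; apply: eq_bigr => S _ /=.
by rewrite !ffunE scalerDl scalerA.
Qed.

HB.instance Definition _ :=
  GRing.isLinear.Build R E E *:%R eder eder_is_linear.

Lemma eder_mono S : eder (emono S) =
  \sum_(i in S) (-1) ^+ #|[set j in S | (j < i)%N]| *: emono (S :\ i).
Proof.
rewrite /eder (bigD1 S) //= ffunE eqxx scale1r [X in _ + X]big1 ?addr0 // => T neTS.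
by rewrite ffunE (negPf neTS) scale0r.
Qed.

Lemma eder_gen i : eder (egen i) = 1.
Proof.
rewrite eder_mono big_set1 setDv (_ : [set j in _ | _] = set0) ?cards0 ?scale1r //.
by apply/setP => j; rewrite !inE; case: (eqVneq j i) => // ->; rewrite ltnn.
Qed.

Lemma eder_genM i b : eder (egen i * b) = b - egen i * eder b.
Proof.
rewrite (ext_expand b).
elim/big_ind: _ => [|x y Hx Hy|T _]; first by rewrite mulr0 raddf0 mulr0 subr0.
  by rewrite mulrDr !raddfD /= Hx Hy mulrDr opprD addrACA.
rewrite -scalerAr !linearZ /= -scalerAr -scalerBr; congr (_ *: _).
rewrite eder_mono mulr_sumr emonoM disjoints1 ninv1.
pose N (S : {set 'I_n}) k := #|[set j in S | (j < k)%N]|.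
case: ifP => [iT|/negbFE iT]; last first.
  rewrite raddf0 (bigD1 i) //= big1 => [|k /andP[kT neki]].
    rewrite -scalerAr emonoM disjoints1 ninv1 !inE eqxx /= setD1K //.
    rewrite (_ : [set j in T :\ i | _] = [set j in T | (j < i)%N]).
      by rewrite scalerA -signr_odd -expr2 sqrr_sign scale1r addr0 subrr.
    by apply/setP => j; rewrite !inE; case: (eqVneq j i) => // ->; rewrite ltnn !andbF.
  by rewrite -scalerAr emonoM disjoints1 !inE eq_sym neki iT scaler0.
rewrite linearZ /= eder_mono (big_setU1 _ iT) /= setU1K // scalerDr.
rewrite (_ : [set j in i |: T | (j < i)%N] = [set j in T | (j < i)%N]); last first.
  by apply/setP => j; rewrite !inE; case: (eqVneq j i) => // ->; rewrite ltnn !andbF.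
rewrite scalerA -signr_odd -expr2 sqrr_sign scale1r; congr (_ + _).
rewrite scaler_sumr -sumrN; apply: eq_bigr => k kT.
have neik : i != k by apply: contraNneq iT => ->.
rewrite -scalerAr emonoM disjoints1 !inE (negPf iT) andbF /= ninv1.
rewrite scalerA scalerA -scaleNr.
have -> : (i |: T) :\ k = i |: T :\ k.
  by apply/setP => j; rewrite !inE; case: (eqVneq j i) => // ->; rewrite neik.
congr (_ *: _).
have -> : #|[set j in i |: T | (j < k)%N]| = ((i < k) + N T k)%N.
  rewrite /N (_ : [set j in i |: T | _] =
             [set j in [set i] | (j < k)%N] :|: [set j in T | (j < k)%N]).
    rewrite cardsU (_ : _ :&: _ = set0) ?cards0 ?subn0; last first.
      by apply/setP => j; rewrite !inE; case: (eqVneq j i) => //= ->; rewrite (negPf iT) andbF.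
    congr (_ + _)%N; case: ltnP => ik.
      rewrite (_ : [set j in _ | _] = [set i]) ?cards1 //.
      by apply/setP => j; rewrite !inE; case: (eqVneq j i) => // ->.
    rewrite (_ : [set j in _ | _] = set0) ?cards0 //.
    by apply/setP => j; rewrite !inE; case: (eqVneq j i) => // ->; rewrite ltnNge ik.
  by apply/setP => j; rewrite !inE andb_orl.
have -> : #|[set j in T | (j < i)%N]|
        = ((k < i) + #|[set j in T :\ k | (j < i)%N]|)%N.
  rewrite (cardsD1 k) !inE kT; congr (_ + _)%N; apply: eq_card => j.
  by rewrite !inE andbA.
have : (i < k)%N + (k < i)%N = 1 :> nat.
  by case: (ltngtP i k) => // /val_inj/eqP; rewrite (negPf neik).
rewrite !signr_odd !exprD.
case: (i < k)%N; case: (k < i)%N => // _; rewrite ?expr0 ?expr1 ?mulN1r ?mul1r.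
  by rewrite mulrN mulrC.
by rewrite mulNr mulrC.
Qed.

Lemma eder1 : eder 1 = 0.
Proof. by rewrite -emono0 eder_mono big_set0. Qed.

Lemma ederM p a b : homog p a ->
  eder (a * b) = eder a * b + (-1) ^+ p * (a * eder b).
Proof.
have mono S : eder (emono S * b) =
    eder (emono S) * b + (-1) ^+ #|S| * (emono S * eder b).
  rewrite emonoE cardE; elim: (enum S) => [|i s IHs] /=.
    by rewrite !big_nil eder1 mul0r add0r !mul1r.
  rewrite big_cons -mulrA !eder_genM IHs exprS.
  move: (\prod_(j <- s) egen j) => x; move: (size s) => k.
  rewrite mulrDr mulrBl opprD addrA !mulrA; congr (_ + _).
  by rewrite (commr_sign (egen i) k) mulN1r !mulNr.
move=> ha; rewrite (ext_expand a).
elim/big_ind: _ => [|x y Hx Hy|S _].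
- by rewrite !mul0r raddf0 mul0r mulr0 addr0.
- by rewrite !mulrDl !raddfD /= Hx Hy mulrDl mulrDr addrACA.
have [->|/ha szS] := eqVneq (a S) 0.
  by rewrite scale0r !mul0r raddf0 mul0r mulr0 addr0.
by rewrite -!scalerAl !linearZ /= mono -szS scalerDr -!scalerAl -scalerAr.
Qed.

Definition is_ideal (J : E -> Prop) : Prop :=
  [/\ J 0,
      forall a b, J a -> J b -> J (a + b)
    & forall c a, J a -> J (c * a) /\ J (a * c)].

Definition ideal_gen (G : E -> Prop) : E -> Prop :=
  fun a => forall J, is_ideal J -> (forall g, G g -> J g) -> J a.

Definition annihilator (J : E -> Prop) : E -> Prop :=
  fun a => forall b, J b -> a * b = 0.

(* Degree-lexicographic order on monomials; the monomial e_S is represented   *)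
(* by its index set S.                                                        *)
Definition deglex_le S T : bool :=
  (#|S| < #|T|)%N ||
  (#|S| == #|T|) && ((enum S : seqlexi 'I_n) <= enum T)%O.

Definition leading a S : Prop :=
  a S != 0 /\ forall T, a T != 0 -> deglex_le T S.

Definition init_monos (A : E -> Prop) : {set 'I_n} -> Prop :=
  fun S => exists a, [/\ A a, a <> 0 & leading a S].

Definition emono_dvd S T : Prop := exists c, emono T = c * emono S.

Definition mono_span (B : {set 'I_n} -> Prop) : {set 'I_n} -> Prop :=
  fun T => exists S, B S /\ emono_dvd S T.

Definition groebner_basis (Z J : E -> Prop) : Prop :=
  (forall a, Z a -> J a) /\ (forall S, init_monos J S <-> mono_span (init_monos Z) S).

Lemma emono_dvdP S T : emono_dvd S T <-> S \subset T.
Proof.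
split=> [[c /ffunP/(_ T)]|sST].
  rewrite [X in _ = X -> _](_ : _ = (\sum_U c U *: (emono U * emono S)) T).
    rewrite ffunE eqxx sum_ffunE => T1; apply: contraT => nsST.
    rewrite big1 ?(rwP eqP) ?oner_eq0 in T1; first by move/eqP: T1; rewrite oner_eq0.
    move=> U _; rewrite ffunE emonoM; case: ifP => _; last by rewrite ffunE scaler0.
    rewrite !ffunE; case: eqP => [eT|_]; last by rewrite !scaler0.
    by rewrite eT subsetUr in nsST.
  congr (fun_of_fin _ _); rewrite {1}(ext_expand c) mulr_suml.
  by apply: eq_bigr => U _; rewrite -scalerAl.
have dTS : [disjoint T :\: S & S] by rewrite -setI_eq0 setIDAC setDIl setDv setI0.
exists ((-1) ^+ ninv (T :\: S) S *: emono (T :\: S)).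
rewrite -scalerAl emonoM dTS scalerA -signr_odd -expr2 sqrr_sign scale1r.
by rewrite setDE setUIl [~: S :|: S]setUC setUCr setIT (setUidPl sST).
Qed.

End ExteriorAlgebra.

Record matroid (n : nat) := Matroid {
  indep : pred {set 'I_n};
  _ : indep set0;
  _ : forall A B : {set 'I_n}, A \subset B -> indep B -> indep A;
  _ : forall A B : {set 'I_n}, indep A -> indep B -> (#|A| < #|B|)%N ->
        exists2 x, x \in B :\: A & indep (x |: A)
}.

Section MatroidTheory.
Variables (n : nat) (M : matroid n).
Implicit Types (A B C S T I J K : {set 'I_n}) (x i : 'I_n).

Definition dependent S : bool := ~~ indep M S.

Definition circuit C : bool := minset dependent C.

Definition simple_matroid : Prop :=
  (forall i, ~~ circuit [set i]) /\
  (forall i j, i != j -> ~~ circuit [set i; j]).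

Definition mrank A : nat := \max_(I in powerset A | indep M I) #|I|.

Definition cl A : {set 'I_n} := [set x | mrank (x |: A) == mrank A].

Definition broken_circuit B : Prop :=
  exists C i, [/\ circuit C, i \in C,
                  forall j, j \in C -> (i <= j)%N & B = C :\ i].

Definition nbc S : Prop := forall B, broken_circuit B -> ~~ (B \subset S).

Definition nbcp (p : nat) S : Prop := nbc S /\ #|S| = p.

(* init_monos the following definitions l is #|T|; note that X_0 is set to be empty.  *)
Definition zX T (p : nat) : {set 'I_n} :=
  if p is 0 then set0 else cl [set x in drop (#|T| - p) (enum T)].

Definition zS T (p : nat) : {set 'I_n} := zX T p :\: zX T p.-1.

Definition zword T : seq 'I_n :=
  flatten [seq enum (zS T p) | p <- iota 1 #|T|].

(* The default value is not used for T in nbc_l, see zpermE.                  *)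
Definition zperm T : 'S_n :=
  odflt 1%g [pick s : 'S_n | codom s == zword T].

Definition zelt (R : comNzRingType) T : extalg R n :=
  (-1) ^+ zperm T * \prod_(1 <= p < #|T|.+1) eder (emono R (zS T p)).

Definition os_ideal (R : comNzRingType) : extalg R n -> Prop :=
  ideal_gen (fun g => exists2 S, dependent S & g = eder (emono R S)).

Lemma indep_set0 : indep M set0.
Proof. by case: M. Qed.

Lemma indepS A B : A \subset B -> indep M B -> indep M A.
Proof. by case: M A B. Qed.

Lemma indep_aug A B : indep M A -> indep M B -> (#|A| < #|B|)%N ->
  exists2 x, x \in B :\: A & indep M (x |: A).
Proof. by case: M A B. Qed.

Lemma mrank_ge A I : I \subset A -> indep M I -> (#|I| <= mrank A)%N.
Proof.
by move=> sIA iI; apply: (leq_bigmax_cond (P := fun I => (I \in powerset A) && indep M I));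
  rewrite powersetE sIA.
Qed.

Lemma mrank_le A (m : nat) :
  (forall I, I \subset A -> indep M I -> (#|I| <= m)%N) -> (mrank A <= m)%N.
Proof.
by move=> h; apply/bigmax_leqP => I; rewrite powersetE => /andP[]; apply: h.
Qed.

Lemma mrankS A B : A \subset B -> (mrank A <= mrank B)%N.
Proof.
by move=> sAB; apply: mrank_le => I sIA; apply: mrank_ge (subset_trans sIA sAB).
Qed.

Lemma mrank_wit A : exists I, [/\ I \subset A, indep M I & #|I| = mrank A].
Proof.
have : exists I, (I \in powerset A) && indep M I.
  by exists set0; rewrite powersetE sub0set indep_set0.
case=> I0 PI0; rewrite /mrank (bigmax_eq_arg I0) //; case: arg_maxnP => // I.
by rewrite powersetE => /andP[? ?] _; exists I.
Qed.

Lemma indep_ext I A : I \subset A -> indep M I ->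
  exists J, [/\ I \subset J, J \subset A, indep M J & #|J| = mrank A].
Proof.
move=> sIA iI; have [K [sKA iK cK]] := mrank_wit A.
have [m] := ubnP (mrank A - #|I|); elim: m I sIA iI => // m IHm I sIA iI lem.
have := mrank_ge sIA iI; rewrite leq_eqVlt => /orP[/eqP cI|ltI]; first by exists I.
have [|x] := indep_aug iI iK; first by rewrite cK.
rewrite inE => /andP[xI xK] ixI.
have sxA : x |: I \subset A by rewrite subUset sub1set (subsetP sKA).
have [|J [sJ ? ? ?]] := IHm (x |: I) sxA ixI.
  rewrite cardsU1 xI add1n; rewrite ltnS in lem.
  by apply: leq_trans lem; rewrite ltn_sub2l.
by exists J; split=> //; apply: subset_trans sJ; apply: subsetUr.
Qed.

Lemma clS A B : A \subset B -> cl A \subset cl B.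
Proof.
move=> sAB; apply/subsetP => x; rewrite !inE => /eqP rA.
rewrite eqn_leq [X in _ && X]mrankS ?subsetUr // andbT leqNgt; apply/negP => ltB.
have [I [sIA iI cI]] := mrank_wit A.
have [J [sIJ sJB iJ cJ]] := indep_ext (subset_trans sIA sAB) iI.
have [K [sK iK cK]] := mrank_wit (x |: B).
have [|y] := indep_aug iJ iK; first by rewrite cJ cK.
rewrite inE => /andP[yJ yK] iyJ.
have ryB : y \notin B.
  apply/negP => yB; have: (#|y |: J| <= mrank B)%N.
    by apply: mrank_ge => //; rewrite subUset sub1set yB.
  by rewrite cardsU1 yJ cJ add1n ltnn.
have := subsetP sK _ yK; rewrite in_setU1 (negPf ryB) orbF => /eqP eyx.
have: (#|y |: I| <= mrank (x |: A))%N.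
  apply: mrank_ge; first by rewrite eyx setUS.
  by apply: indepS iyJ; rewrite setUS.
by rewrite rA cardsU1 (contra (subsetP sIJ y)) // cI add1n ltnn.
Qed.

Lemma zXS T p : zX T p \subset zX T p.+1.
Proof.
case: p => [|p]; first exact: sub0set.
apply: clS; apply/subsetP => x; rewrite !inE.
have -> : drop (#|T| - p.+1) (enum T)
        = drop (#|T| - p.+1 - (#|T| - p.+2)) (drop (#|T| - p.+2) (enum T)).
  by rewrite drop_drop subnK // leq_sub2l.
exact: mem_drop.
Qed.

Lemma zword_take T m (s := flatten [seq enum (zS T p) | p <- iota 1 m]) :
  uniq s /\ s =i zX T m.
Proof.
rewrite {}/s; elim: m => [|m [us ms]]; first by split=> // x; rewrite inE.
have -> : iota 1 m.+1 = iota 1 m ++ [:: m.+1] by rewrite -[m.+1]addn1 iotaD addnC.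
rewrite map_cat flatten_cat /= cats0; split=> [|x].
  rewrite cat_uniq us enum_uniq andbT; apply/hasPn => x.
  by rewrite mem_enum !inE /= ms => /andP[].
rewrite mem_cat ms mem_enum in_setD /=.
by have := subsetP (zXS T m) x; case: (x \in zX T m) => //= ->.
Qed.

Lemma nbc_indep T : nbc T -> indep M T.
Proof.
move=> nT; apply: contraT => dT; have [C mC sCT] := minset_exists (P := dependent) dT.
have /set0Pn[i0 i0C] : C != set0.
  by apply: contraTneq (minsetp mC) => ->; rewrite /dependent indep_set0.
case: (arg_minnP val i0C) => i iC imin.
have /nT/negP[] : broken_circuit (C :\ i) by exists C, i; split.
exact: subset_trans (subsetDl _ _) sCT.
Qed.

Lemma simple_cl0 : simple_matroid -> cl set0 = set0.
Proof.
move=> [loopless _]; apply/setP => x; rewrite !inE setU0; apply/negP => /eqP r0.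
have r00 : mrank set0 = 0%N.
  by apply/eqP; rewrite -leqn0; apply: mrank_le => I; rewrite subset0 => /eqP->;
    rewrite cards0.
have ix : ~~ indep M [set x].
  apply/negP => ix; have := mrank_ge (subxx _) ix.
  by rewrite r0 r00 cards1.
case/negP: (loopless x); apply/minsetP; split=> // B dB.
rewrite subset1 => /orP[/eqP//|/eqP B0].
by move: dB; rewrite /dependent B0 indep_set0.
Qed.

Lemma nbc_spanning T : simple_matroid -> nbcp (mrank setT) T ->
  zX T #|T| = setT.
Proof.
move=> sM [nT cT]; have rT : mrank T = mrank setT.
  apply/eqP; rewrite eqn_leq mrankS ?subsetT //= -cT.
  by apply: mrank_ge => //; apply: nbc_indep.
have -> : zX T #|T| = cl T.
  rewrite /zX subnn drop0 set_enum; case eT: #|T| => [|m] //.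
  by rewrite (cards0_eq eT) simple_cl0.
apply/setP => x; rewrite !inE eqn_leq [X in _ && X]mrankS ?subsetUr // andbT.
by rewrite rT mrankS ?subsetT.
Qed.

Lemma zpermE T : simple_matroid -> nbcp (mrank setT) T ->
  codom (zperm T) = zword T.
Proof.
move=> sM nT; rewrite /zperm; case: pickP => [s /eqP//|no].
have [uw mw] := zword_take T #|T|; rewrite nbc_spanning // in mw.
have sw : size (zword T) = n.
  rewrite -[RHS]card_ord -cardsT -(card_uniqP uw).
  by apply: eq_card => x; rewrite mw.
pose f (i : 'I_n) := nth i (zword T) i.
have injf : injective f.
  move=> i j; rewrite /f (set_nth_default i) ?sw // => /eqP.
  by rewrite nth_uniq ?sw // => /eqP/val_inj.
case/negP: (no (perm injf)); apply/eqP.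
rewrite /codom /image_mem (eq_map (permE injf)).
case Ez: (zword T) => [|x0 w].
  by apply: size0nil; rewrite size_map size_enum_ord -sw Ez.
rewrite -Ez; apply: (@eq_from_nth _ x0).
  by rewrite size_map size_enum_ord sw.
rewrite size_map size_enum_ord => i lti; pose i' := Ordinal lti.
rewrite (nth_map i') ?size_enum_ord // (nth_ord_enum i' i') /f.
by apply: set_nth_default; rewrite sw.
Qed.

End MatroidTheory.

Arguments zelt {n} M R T.
Arguments os_ideal {n} M R _.

(* Main.v *)
Require Import Defs.
From mathcomp Require Import all_boot all_order all_fingroup all_algebra.

Set Implicit Arguments.
Unset Strict Implicit.
Unset Printing Implicit Defensive.

Import Order.TTheory GRing.Theory.
Local Open Scope ring_scope.

(* The leading monomial of z(T) is that of the complement of T, since for T   *)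
(* nbc the least element of S_p is i_(l-p+1). If D meets every S_p in at most *)
(* one point then D is independent; hence z(T) e_D = 0 for D dependent, and   *)
(* applying the derivation, which kills z(T), gives z(T) in the annihilator.  *)
(* Conversely, let e_S lead some a in the annihilator. If the complement U of *)
(* S contained a broken circuit, e_U would lead an element b of the ideal     *)
(* with unit coefficient, and the top coefficient of a b would be nonzero. So *)
(* U is nbc, hence contained in some T in nbc_l, and S contains the           *)
(* complement of T.                                                           *)

(** The argument runs by complementation, and leading monomials are tracked by [unit_leading]:
    homogeneity plus a leading coefficient of square 1, which survives products over any ring
    ([unit_leadingM]). [leading_mul_compl] forces the complement of a leading monomial of the
    annihilator to be nbc, [nbc_ext] completes that complement to some T, and [flag_prod_leading]
    gives z(T) the leading set [~: T]. That z(T) annihilates the ideal rests on [transversal_indep]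
    and [eder_flag_prod]. *)

Section LexWeight.
Variable n : nat.
Implicit Types (S T U : {set 'I_n}) (s t : seq 'I_n).

(* Among sets of equal cardinality, lexicographically larger means smaller    *)
(* weight; additivity of the weight makes the order multiplicative.           *)
Definition lex_weight S : nat := (\sum_(i in S) 2 ^ (n - i))%N.

(** The exponents are distinct and below [n - x], so this is the usual bound on a binary
    expansion. *)
Lemma path_weight_lt (x : 'I_n) s : path ltn (val x) [seq val i | i <- s] ->
  (\sum_(i <- s) 2 ^ (n - i) < 2 ^ (n - x))%N.
Proof.
elim: s x => [|y s IHs] x /=; first by rewrite big_nil expn_gt0.
case/andP=> ltxy /IHs lts; rewrite big_cons.
apply: (@leq_trans (2 ^ (n - y) + 2 ^ (n - y))); first by rewrite ltn_add2l.
by rewrite addnn -mul2n -expnS leq_exp2l // ltn_sub2l.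
Qed.

Lemma sorted_lexi_weight s t : size s = size t ->
  sorted ltn [seq val i | i <- s] -> sorted ltn [seq val i | i <- t] ->
  ((s : seqlexi 'I_n) <= t)%O =
    (\sum_(i <- t) 2 ^ (n - i) <= \sum_(i <- s) 2 ^ (n - i))%N.
Proof.
elim: s t => [|x s IHs] [|y t] //=; first by rewrite !big_nil lexx.
case=> sz ps pt; rewrite lexi_cons !big_cons !leEord.
have ltw (u v : 'I_n) (r : seq 'I_n) : (u < v)%N -> path ltn v [seq val i | i <- r] ->
    (2 ^ (n - v) + \sum_(i <- r) 2 ^ (n - i) < 2 ^ (n - u))%N.
  by move=> uv pr; have := @path_weight_lt u (v :: r); rewrite /= uv big_cons; apply.
have [ltxy|ltyx|exy] := ltngtP x y.
- rewrite /=; symmetry.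
  exact: leq_trans (ltnW (ltw _ _ _ ltxy pt)) (leq_addr _ _).
- rewrite /=; symmetry; apply: negbTE; rewrite -ltnNge.
  exact: leq_trans (ltw _ _ _ ltyx ps) (leq_addr _ _).
- move/val_inj: exy => <-; rewrite leq_add2l /=; apply: IHs => //.
    exact: path_sorted ps.
  exact: path_sorted pt.
Qed.

Lemma enum_lexi_weight S T : #|S| = #|T| ->
  ((enum S : seqlexi 'I_n) <= enum T)%O = (lex_weight T <= lex_weight S)%N.
Proof.
move=> eST; rewrite sorted_lexi_weight ?sorted_enum_ord -?cardE //.
by rewrite /lex_weight !big_enum.
Qed.

Lemma lex_weight_inj S T : #|S| = #|T| -> lex_weight S = lex_weight T -> S = T.
Proof.
move=> eST ew; apply/setP => x; rewrite -mem_enum -[RHS]mem_enum.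
congr (x \in _); apply: (@le_anti _ (seqlexi 'I_n)).
by rewrite !enum_lexi_weight ?ew ?leqnn.
Qed.

Lemma deglex_leE S T : deglex_le S T =
  (#|S| < #|T|)%N || (#|S| == #|T|) && (lex_weight T <= lex_weight S)%N.
Proof.
by rewrite /deglex_le; case: eqP => //= /enum_lexi_weight ->.
Qed.

Lemma lex_weightU S T : [disjoint S & T] ->
  lex_weight (S :|: T) = (lex_weight S + lex_weight T)%N.
Proof. by move=> d; rewrite /lex_weight -bigU //; apply: eq_bigl => i; rewrite inE. Qed.

Lemma lex_weightD1 i S : i \in S ->
  lex_weight S = (2 ^ (n - i) + lex_weight (S :\ i))%N.
Proof. by move=> iS; rewrite /lex_weight (big_setD1 i). Qed.

Lemma lex_weightC S : (lex_weight S + lex_weight (~: S))%N = lex_weight setT.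
Proof. by rewrite -lex_weightU ?setUCr // -setI_eq0 setICr. Qed.

End LexWeight.

(** * Leading monomials in the exterior algebra *)

Section Leading.
Variables (R : comNzRingType) (n : nat).
Local Notation E := (extalg R n).
Implicit Types (S T U A B D : {set 'I_n}) (a b c : E) (i j : 'I_n).

Lemma emono_mulE A B U : emono_mul R A B U =
  if [disjoint A & B] && (U == A :|: B) then (-1) ^+ ninv A B else 0.
Proof.
rewrite /emono_mul; case: ifP => _ /=; last by rewrite ffunE.
by rewrite !ffunE; case: eqP => _; rewrite /GRing.scale /= ?mulr1 ?mulr0.
Qed.

Lemma ext_mulE a b U : (a * b) U =
  \sum_(A : {set 'I_n}) \sum_(B : {set 'I_n}) a A * b B * emono_mul R A B U.
Proof.
rewrite [a * b]/(ext_mul a b) /ext_mul sum_ffunE; apply: eq_bigr => A _.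
by rewrite sum_ffunE; apply: eq_bigr => B _; rewrite ffunE.
Qed.

Lemma ext_mul_supp a b U : (a * b) U != 0 ->
  exists A B, [/\ a A != 0, b B != 0, [disjoint A & B] & U = A :|: B].
Proof.
rewrite ext_mulE => nz.
have [/existsP[A /existsP[B /and4P[? ? ? /eqP ?]]]|] :=
  boolP [exists A, exists B, [&& a A != 0, b B != 0, [disjoint A & B]
    & U == A :|: B]]; first by exists A, B.
move/existsPn=> no; case/negP: nz; apply/eqP.
apply: big1 => A _; apply: big1 => B _; rewrite emono_mulE.
have /existsPn/(_ B) := no A.
have [->|_] := eqVneq (a A) 0; first by rewrite !mul0r.
have [->|_] := eqVneq (b B) 0; first by rewrite mulr0 mul0r.
by move=> /= /negbTE ->; rewrite mulr0.
Qed.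

(* The coefficient of [emono S] is required to be a square root of 1, so that *)
(* it is regular over any [R].                                                *)
Definition unit_leading a S : Prop :=
  a S ^+ 2 = 1 /\
  forall U, a U != 0 -> #|U| = #|S| /\ (lex_weight S <= lex_weight U)%N.

Lemma sqr1_neq0 (x : R) : x ^+ 2 = 1 -> x != 0.
Proof. by apply: contra_eq_neq => ->; rewrite expr0n eq_sym oner_eq0. Qed.

Lemma unit_leading_homog a S : unit_leading a S -> homog #|S| a.
Proof. by case=> _ h U /h[]. Qed.

Lemma unit_leadingP a S : unit_leading a S -> leading a S.
Proof.
case=> sq h; split=> [|U /h[cU wU]]; first exact: sqr1_neq0.
by rewrite deglex_leE cU eqxx wU orbT.
Qed.

Lemma unit_leading_mono S : unit_leading (emono R S) S.
Proof.
split=> [|U]; first by rewrite ffunE eqxx expr1n.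
by rewrite ffunE; have [->|] := eqVneq U S; rewrite ?eqxx.
Qed.

Lemma unit_leadingM a b S T : [disjoint S & T] ->
  unit_leading a S -> unit_leading b T -> unit_leading (a * b) (S :|: T).
Proof.
move=> dST [sqa ha] [sqb hb]; split=> [|U]; last first.
  case/ext_mul_supp=> A [B [/ha[cA wA] /hb[cB wB] dAB ->]].
  by rewrite !lex_weightU // leq_add // !cardsU !disjoint_setI0 // cards0 cA cB.
suff -> : (a * b) (S :|: T) = a S * b T * (-1) ^+ ninv S T.
  by rewrite !exprMn sqa sqb !mul1r -exprM mulnC exprM sqrrN expr1n expr1n.
(* Only the pair S, T reaches this monomial: weights add up, and neither [A] nor [B] can be lighter
   than its leading set, so both weights agree. *)
have no A B : a A != 0 -> b B != 0 -> [disjoint A & B] ->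
    S :|: T = A :|: B -> A = S /\ B = T.
  move=> /ha[cA wA] /hb[cB wB] dAB eU.
  have := lex_weightU dST; rewrite eU lex_weightU // => ew.
  have eA : lex_weight A = lex_weight S.
    apply/eqP; rewrite eqn_leq wA andbT -(leq_add2r (lex_weight T)) -ew.
    by rewrite leq_add2l.
  split; apply: lex_weight_inj => //.
  by move/eqP: ew; rewrite eA eqn_add2l => /eqP.
rewrite ext_mulE (bigD1 S) //= (bigD1 T) //= emono_mulE dST eqxx /=.
rewrite big1 => [|B neBT]; last first.
  rewrite emono_mulE; case: ifP => [/andP[dSB /eqP eU]|]; last by rewrite mulr0.
  have [->|bB] := eqVneq (b B) 0; first by rewrite mulr0 mul0r.
  have [|_ eB] := no S B _ bB dSB eU; first exact: sqr1_neq0.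
  by rewrite eB eqxx in neBT.
rewrite addr0 big1 ?addr0 // => A neAS; apply: big1 => B _.
rewrite emono_mulE; case: ifP => [/andP[dSB /eqP eU]|]; last by rewrite mulr0.
have [->|bB] := eqVneq (b B) 0; first by rewrite mulr0 mul0r.
have [->|aA] := eqVneq (a A) 0; first by rewrite !mul0r.
by have [eA _] := no A B aA bB dSB eU; rewrite eA eqxx in neAS.
Qed.

Lemma unit_leading_sign k a S : unit_leading a S -> unit_leading ((-1) ^+ k * a) S.
Proof.
case=> sq h; rewrite -signr_odd; case: odd; rewrite ?expr0 ?mul1r // expr1 mulN1r.
by split=> [|U]; rewrite ffunE ?sqrrN // oppr_eq0 => /h.
Qed.

Lemma unit_leading_uniq a S T : leading a S -> unit_leading a T -> S = T.
Proof.
case=> aS ha [sq h]; have [cS wS] := h _ aS.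
have := ha T (sqr1_neq0 sq); rewrite deglex_leE cS ltnn eqxx /= => wT.
by apply: lex_weight_inj => //; apply/eqP; rewrite eqn_leq wT wS.
Qed.

Lemma eder_mono_supp S U : eder (emono R S) U != 0 ->
  exists2 i, i \in S & U = S :\ i.
Proof.
rewrite eder_mono sum_ffunE => nz.
have [/existsP[i /andP[iS /eqP ?]]|/existsPn no] :=
  boolP [exists i, (i \in S) && (U == S :\ i)]; first by exists i.
case/negP: nz; apply/eqP/big1 => i iS; have := no i.
by rewrite iS /= => /negbTE neU; rewrite !ffunE neU scaler0.
Qed.

(** Deleting the least element leaves the lexicographically largest of the sets [S :\ i]. *)
Lemma unit_leading_eder S m : m \in S -> (forall i, i \in S -> (m <= i)%N) ->
  unit_leading (eder (emono R S)) (S :\ m).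
Proof.
move=> mS min_m; split=> [|U /eder_mono_supp[i iS ->]].
  rewrite eder_mono sum_ffunE (bigD1 m) //= big1 => [|i /andP[iS neim]].
    by rewrite addr0 !ffunE eqxx /GRing.scale /= mulr1 -exprM mulnC exprM sqrrN !expr1n.
  rewrite !ffunE; case: eqP => [/setP/(_ i)|_]; last by rewrite scaler0.
  by rewrite !inE eqxx neim iS.
split; first by apply/eqP; have := cardsD1 m S; rewrite mS (cardsD1 i) iS => /eqP.
have := lex_weightD1 mS; rewrite (lex_weightD1 iS) => ew.
rewrite -(leq_add2l (2 ^ (n - m))) -ew leq_add2r leq_exp2l //.
by rewrite leq_sub2l // min_m.
Qed.

Lemma disjoint_setT_compl A B : [disjoint A & B] -> setT = A :|: B -> B = ~: A.
Proof.
move=> dAB /setP eU; apply/setP=> x; have := eU x; rewrite !inE.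
by case: (boolP (x \in A)) => [/(disjointFr dAB)|_] /=.
Qed.

(* Taking complements reverses the lexicographic order, so only A = S         *)
(* contributes to the top coefficient of the product.                         *)
Lemma leading_mul_compl a b S : leading a S -> unit_leading b (~: S) ->
  a * b != 0.
Proof.
case=> aS ha [sqb hb]; apply/eqP=> /ffunP/(_ setT); rewrite ext_mulE ffunE.
rewrite (bigD1 S) //= (bigD1 (~: S)) //= emono_mulE setUCr eqxx andbT.
rewrite -setI_eq0 setICr eqxx /= big1 => [|B neB]; last first.
  rewrite emono_mulE; case: ifP => [/andP[dSB /eqP eU]|]; last by rewrite mulr0.
  by rewrite (disjoint_setT_compl dSB eU) eqxx in neB.
rewrite addr0 big1 ?addr0 => [|A neA]; last first.
  apply: big1 => B _; rewrite emono_mulE.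
  case: ifP => [/andP[dAB /eqP eU]|]; last by rewrite mulr0.
  have eB := disjoint_setT_compl dAB eU.
  have [->|bB] := eqVneq (b B) 0; first by rewrite mulr0 mul0r.
  have [->|aA] := eqVneq (a A) 0; first by rewrite !mul0r.
  have [cB wB] := hb _ bB; rewrite eB in cB wB.
  have cA : #|A| = #|S|.
    have := cardsC A; rewrite cB -(cardsC S) => /eqP.
    by rewrite eqn_add2r => /eqP.
  have := ha _ aA; rewrite deglex_leE cA ltnn eqxx /= => wA.
  suff eA : A = S by rewrite eA eqxx in neA.
  apply: lex_weight_inj => //; apply/eqP; rewrite eqn_leq wA andbT.
  by rewrite -(leq_add2r (lex_weight (~: A))) lex_weightC -(lex_weightC S) leq_add2l.
set k := (-1) ^+ _; have sqk : k * k = 1 by rewrite -expr2 sqrr_sign.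
(* The sign and the coefficient of [b] both square to 1, so this factor cancels them and leaves
   [a S = 0]. *)
move/(congr1 (fun x => x * (k * b (~: S)))); rewrite mul0r.
by rewrite -!mulrA (mulrA k) sqk mul1r -expr2 sqb mulr1 => /eqP; apply/negP.
Qed.

Lemma ideal_gen_ideal (G : E -> Prop) : is_ideal (ideal_gen G).
Proof.
split=> [J [J0 _ _] _ //|a b Ja Jb J iJ GJ|c a Ja].
  by case: (iJ) => _ JD _; apply: JD; [apply: Ja | apply: Jb].
by split=> J iJ GJ; case: (iJ) => _ _ /(_ c a (Ja J iJ GJ))[].
Qed.

Lemma annihilatorMr (J : E -> Prop) a c :
  is_ideal J -> annihilator J a -> annihilator J (a * c).
Proof. by case=> _ _ JM aJ b /(JM c)[/aJ cb _]; rewrite -mulrA. Qed.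

Lemma eder_eder a : eder (eder a) = 0.
Proof.
rewrite (ext_expand a); elim/big_ind: _ => [|x y Hx Hy|S _]; first by rewrite !raddf0.
  by rewrite !raddfD /= Hx Hy addr0.
rewrite !linearZ /= emonoE; suff -> : eder (eder (\prod_(i <- enum S) egen R i)) = 0.
  by rewrite scaler0.
elim: (enum S) => [|i s IHs]; first by rewrite big_nil eder1 raddf0.
by rewrite big_cons eder_genM raddfB /= eder_genM IHs mulr0 subr0 subrr.
Qed.

Lemma ninvC S T : [disjoint S & T] -> (ninv S T + ninv T S = #|S| * #|T|)%N.
Proof.
move=> dST; rewrite /ninv [X in (_ + X)%N]exchange_big -big_split -sum_nat_const.
apply: eq_bigr => i iS; rewrite -big_split -[RHS]muln1 -sum_nat_const.
apply: eq_bigr => j jT; case: (ltngtP i j) => // /val_inj eij.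
by have := disjointFr dST iS; rewrite eij jT.
Qed.

Lemma homog_mulC p a U : homog p a ->
  a * emono R U = (-1) ^+ (p * #|U|) *: (emono R U * a).
Proof.
move=> ha; rewrite (ext_expand a) mulr_suml mulr_sumr scaler_sumr.
apply: eq_bigr => A _; rewrite -scalerAl -scalerAr scalerA mulrC -scalerA.
have [->|/ha cA] := eqVneq (a A) 0; first by rewrite !scale0r.
congr (_ *: _); rewrite !emonoM disjoint_sym; case: ifP => dUA; last by rewrite scaler0.
rewrite scalerA setUC; congr (_ *: _).
have <- : (ninv A U + ninv U A)%N = (p * #|U|)%N.
  by rewrite ninvC ?cA // disjoint_sym.
by rewrite exprD -mulrA -expr2 sqrr_sign mulr1.
Qed.

End Leading.

(** * Closure, circuits and nbc sets *)

Section BrokenCircuits.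
Variables (n : nat) (M : matroid n).
Implicit Types (A B C D S T U I J : {set 'I_n}) (i x y : 'I_n).

Lemma sub_cl A : A \subset cl M A.
Proof. by apply/subsetP=> x xA; rewrite inE setUC (setUidPl _) // sub1set. Qed.

Lemma mrank_cl A : mrank M (cl M A) = mrank M A.
Proof.
apply/eqP; rewrite eqn_leq [X in _ && X]mrankS ?sub_cl // andbT leqNgt; apply/negP => lt.
have [I [sI iI cI]] := mrank_wit M A; have [J [sJ iJ cJ]] := mrank_wit M (cl M A).
have [|y] := indep_aug iI iJ; first by rewrite cI cJ.
rewrite inE => /andP[yI yJ] iyI; have := subsetP sJ _ yJ; rewrite inE => /eqP ry.
by have := mrank_ge (setUS [set y] sI) iyI; rewrite ry cardsU1 yI cI add1n ltnn.
Qed.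

(** Extend [I] to a basis [J] of the flat. The rank grows when [x] is adjoined, and an element
    augmenting [J] cannot lie in the flat, so it is [x]. *)
Lemma indepU1_notin_cl A I x : I \subset cl M A -> indep M I -> x \notin cl M A ->
  indep M (x |: I).
Proof.
move=> sI iI xA; have [J [sIJ sJ iJ cJ]] := indep_ext sI iI.
have ltr : (mrank M (cl M A) < mrank M (x |: cl M A))%N.
  apply: (@leq_trans (mrank M (x |: A))); last by rewrite mrankS // setUS ?sub_cl.
  rewrite mrank_cl ltn_neqAle mrankS ?subsetUr // andbT eq_sym.
  by move: xA; rewrite inE.
have [K [sK iK cK]] := mrank_wit M (x |: cl M A).
have [|y] := indep_aug iJ iK; first by rewrite cJ cK.
rewrite inE => /andP[yJ yK] iyJ.
have := subsetP sK _ yK; rewrite in_setU1 => /predU1P[eyx|ycl].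
  by apply: indepS iyJ; rewrite eyx setUS.
have := @mrank_ge _ M (cl M A) (y |: J); rewrite subUset sub1set ycl sJ iyJ.
by rewrite cardsU1 yJ cJ add1n ltnn => /(_ isT isT).
Qed.

Lemma mrank_indep I : indep M I -> mrank M I = #|I|.
Proof.
move=> iI; apply/eqP; rewrite eqn_leq mrank_ge // andbT.
by apply: mrank_le => J sJ _; apply: subset_leq_card.
Qed.

Lemma indep_cl_mem I A x : indep M I -> A \subset I -> x \in I -> x \in cl M A ->
  x \in A.
Proof.
move=> iI sA xI; rewrite inE => /eqP; apply: contra_eqT => xA.
rewrite !mrank_indep ?(indepS _ iI) // ?subUset ?sub1set ?xI //.
by rewrite cardsU1 xA add1n gtn_eqF.
Qed.

Lemma circuit_dep C : circuit M C -> ~~ indep M C.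
Proof. by move/minsetp. Qed.

Lemma circuitD1_indep C i : circuit M C -> i \in C -> indep M (C :\ i).
Proof.
case/minsetP=> _ minC iC; apply: contraT => dC.
by have /setP/(_ i) := minC _ dC (subsetDl _ _); rewrite !inE eqxx iC.
Qed.

(** Were [x] below all of [A], a circuit in [x |: A] would pass through [x] as its minimum, and
    deleting [x] would leave a broken circuit inside [T]. *)
Lemma nbc_cl_min T A x : nbc M T -> A \subset T -> x \in cl M A ->
  exists2 t, t \in A & (t <= x)%N.
Proof.
move=> nT sA xA; have iA := indepS sA (nbc_indep nT).
have [/existsP[t /andP[]]|/existsPn no] := boolP [exists t, (t \in A) && (t <= x)%N].
  by exists t.
have ltx t : t \in A -> (x < t)%N by move=> tA; have := no t; rewrite tA -ltnNge.
have xnA : x \notin A by apply/negP=> /ltx; rewrite ltnn.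
have dxA : dependent M (x |: A).
  apply/negP=> ixA; move: xA; rewrite inE !mrank_indep // cardsU1 xnA add1n.
  by rewrite gtn_eqF.
have [C mC sC] := minset_exists dxA.
have xC : x \in C.
  apply: contraT => xC; case/negP: (circuit_dep mC); apply: indepS iA.
  apply/subsetP=> y yC; have := subsetP sC _ yC; rewrite in_setU1.
  by case/predU1P=> // eyx; rewrite -eyx yC in xC.
have /nT/negP[] : broken_circuit M (C :\ x).
  exists C, x; split=> // j jC; have := subsetP sC _ jC; rewrite in_setU1.
  by case/predU1P=> [->//|/ltx/ltnW].
by apply: subset_trans sA; rewrite subDset.
Qed.

(** A basis of [i |: B] containing [C :\ y] must omit [y], and by cardinality it is all of
    [i |: B :\ y]. *)
Lemma circuit_exchange B C i y : indep M B -> circuit M C -> C \subset i |: B ->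
  i \in C -> y \in C -> y != i -> indep M (i |: B :\ y).
Proof.
move=> iB cC sC iC yC neyi.
have iB' : i \notin B.
  apply/negP=> iB'; case/negP: (circuit_dep cC); apply: indepS iB.
  by rewrite (setUidPr _) ?sub1set in sC.
have [K [sCK sK iK cK]] :=
  indep_ext (subset_trans (subsetDl C [set y]) sC) (circuitD1_indep cC yC).
have yK : y \notin K.
  apply/negP=> yK; case/negP: (circuit_dep cC); apply: indepS iK.
  by rewrite -(setD1K yC) subUset sub1set yK.
have yB : y \in B.
  by have := subsetP sC _ yC; rewrite in_setU1 (negPf neyi).
suff <- : K = i |: B :\ y by [].
apply/eqP; rewrite eqEcard; apply/andP; split.
  apply/subsetP=> x xK; have := subsetP sK _ xK; rewrite !inE.
  by case: (eqVneq x y) => [exy|]; rewrite ?exy ?(negPf yK) // -exy xK in yK *.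
rewrite cK; have := mrank_ge (subsetUr [set i] B) iB; apply: leq_trans.
by rewrite cardsU1 !inE (negPf iB') andbF add1n (cardsD1 y B) yB add1n.
Qed.

(* Among the bases containing U, one of minimal index sum is nbc: otherwise   *)
(* exchanging an element of a broken circuit outside U for the deleted        *)
(* minimum would decrease the sum.                                            *)
Lemma nbc_ext U : nbc M U -> exists2 T, nbcp M (mrank M setT) T & U \subset T.
Proof.
move=> nU; pose P B := [&& U \subset B, indep M B & #|B| == mrank M setT].
have [B0 PB0] : exists B, P B.
  have [B [sUB _ iB cB]] := indep_ext (subsetT U) (nbc_indep nU).
  by exists B; rewrite /P sUB iB cB eqxx.
case: (arg_minnP (fun B => \sum_(i in B) val i)%N PB0) => B.
case/and3P=> sUB iB /eqP cB minB; exists B => //; split=> // _ [C [i [cC iC minC ->]]].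
apply/negP=> sCB.
have sC : C \subset i |: B by rewrite -subDset.
have iB' : i \notin B.
  apply/negP=> iB'; case/negP: (circuit_dep cC); apply: indepS iB.
  by rewrite (setUidPr _) ?sub1set in sC.
have /subsetPn[y yC yU] : ~~ (C :\ i \subset U) by apply: nU; exists C, i.
have yB := subsetP sCB _ yC; move: yC; rewrite !inE => /andP[neyi yC].
have iB'y : i \notin B :\ y by rewrite !inE (negPf iB') andbF.
have := minB (i |: B :\ y); rewrite /P (circuit_exchange iB cC) //.
rewrite cardsU1 iB'y -cB (cardsD1 y B) yB eqxx /=.
have -> : U \subset i |: B :\ y.
  apply/subsetP=> x xU; rewrite !inE (subsetP sUB) // andbT.
  by rewrite orbC; case: eqVneq => // exy; rewrite -exy xU in yU.
move=> /(_ isT); rewrite (big_setU1 _ iB'y) (big_setD1 y yB) /= leq_add2r.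
by rewrite leqNgt ltn_neqAle minC // andbT eq_sym neyi.
Qed.

End BrokenCircuits.

(** * The flag of an nbc set and its product of boundaries *)

Section Flag.
Variables (n : nat) (M : matroid n) (T : {set 'I_n}).
Hypotheses (simpleM : simple_matroid M) (nbcT : nbc M T).
Implicit Types (S D : {set 'I_n}) (x t : 'I_n) (p : nat).

Let A p := [set x in drop (#|T| - p) (enum T)].

Lemma flag_gensS p : (p < #|T|)%N -> exists t,
  [/\ t \in T, A p.+1 = t |: A p, t \notin A p & forall x, x \in A p -> (t < x)%N].
Proof.
move=> ltp; have lt : (#|T| - p.+1 < size (enum T))%N.
  by rewrite -cardE ltn_subrL (leq_ltn_trans _ ltp).
have [t0 _] : exists t, t \in T by apply/set0Pn; rewrite -card_gt0 (leq_ltn_trans _ ltp).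
pose t := nth t0 (enum T) (#|T| - p.+1).
have ed : drop (#|T| - p.+1) (enum T) = t :: drop (#|T| - p) (enum T).
  by rewrite (drop_nth t0) // -subSn.
have := drop_sorted (#|T| - p.+1) (sorted_enum_ord T).
rewrite -map_drop ed /= (path_sortedE ltn_trans) => /andP[/allP ltt _].
have lttA x : x \in A p -> (t < x)%N by rewrite inE => xA; apply: ltt; rewrite map_f.
exists t; split=> //; first by rewrite -mem_enum mem_nth.
  by rewrite /A ed set_cons.
by apply/negP=> /lttA; rewrite ltnn.
Qed.

Lemma flag_gens_sub p : A p \subset T.
Proof. by apply/subsetP=> x; rewrite inE => /mem_drop; rewrite mem_enum. Qed.

(** The case [p = 0] is where simplicity enters: the closure of the empty set is empty. *)
Lemma zX_cl p : zX M T p = cl M (A p).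
Proof.
case: p => // ; rewrite /= /A subn0 drop_oversize -?cardE //.
by rewrite (_ : [set x in _] = set0) ?simple_cl0 //; apply/setP=> x; rewrite !inE.
Qed.

(** Independence of T leaves only the newly added generator in this block; [nbc_cl_min] makes it the
    least element. *)
Lemma nbc_zS p : (p < #|T|)%N -> exists t,
  [/\ t \in zS M T p.+1, T :&: zS M T p.+1 = [set t]
    & forall x, x \in zS M T p.+1 -> (t <= x)%N].
Proof.
case/flag_gensS=> t [tT eA tA ltA]; exists t; rewrite /zS !zX_cl /=.
have iT := nbc_indep nbcT.
have mA q x : x \in T -> (x \in cl M (A q)) = (x \in A q).
  move=> xT; apply/idP/idP=> [|xA]; first exact: indep_cl_mem (flag_gens_sub q) xT.
  exact: subsetP (sub_cl _ _) _ xA.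
split=> [||x].
- by rewrite inE !mA // eA setU11 tA.
- apply/setP=> x; rewrite inE in_setD; case: (boolP (x \in T)) => [xT|xT] /=.
    rewrite !mA // eA in_setU1 in_set1.
    by case: eqVneq => [->|_]; rewrite ?tA //; case: (x \in A p).
  by rewrite inE; case: eqVneq => // ext; rewrite ext tT in xT.
rewrite in_setD eA => /andP[_ xcl].
have [|u] := nbc_cl_min nbcT _ xcl; first by rewrite -eA flag_gens_sub.
rewrite in_setU1 => /predU1P[->//|/ltA ltu] leu.
exact: leq_trans (ltnW ltu) leu.
Qed.

(** Each step up the flag adds at most one element, and it lies outside the preceding flat. *)
Lemma transversal_indep D m :
  (forall p, (p < m)%N -> #|D :&: zS M T p.+1| <= 1)%N -> indep M (D :&: zX M T m).
Proof.
elim: m => [|m IHm] le1; first by rewrite /= setI0 indep_set0.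
have {}IHm : indep M (D :&: zX M T m) by apply: IHm => p ltp; apply/le1/ltnW.
have eX : zX M T m.+1 = zX M T m :|: zS M T m.+1.
  apply/setP=> x; have := subsetP (zXS M T m) x; rewrite in_setU in_setD /=.
  by case: (x \in zX M T m) => //= ->.
rewrite eX setIUr; have := le1 m (ltnSn m); rewrite leq_eqVlt ltnS leqn0.
case/orP=> [/cards1P[x ex]|/eqP/cards0_eq->]; last by rewrite setU0.
have /setIP[_ /setDP[_ xX]] : x \in D :&: zS M T m.+1 by rewrite ex set11.
rewrite ex setUC.
by apply: (@indepU1_notin_cl _ _ (A m)) IHm _; rewrite -zX_cl ?subsetIr.
Qed.

Section FlagProduct.
Variable R : comNzRingType.

(** z(T) without its sign, truncated to [m] factors to allow induction along the flag. *)
Definition flag_prod m : extalg R n := \prod_(1 <= p < m.+1) eder (emono R (zS M T p)).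

Lemma flag_prodS m : flag_prod m.+1 = flag_prod m * eder (emono R (zS M T m.+1)).
Proof. by rewrite /flag_prod big_nat_recr. Qed.

(** Each factor leads with its block minus the block's least element, which is its only element of
    T. *)
Lemma flag_prod_leading m : (m <= #|T|)%N ->
  unit_leading (flag_prod m) (zX M T m :\: T).
Proof.
elim: m => [_|m IHm ltm].
  by rewrite /flag_prod big_geq // set0D; apply: unit_leading_mono.
have [t [tS eT min_t]] := nbc_zS ltm.
have -> : zX M T m.+1 :\: T = (zX M T m :\: T) :|: (zS M T m.+1 :\ t).
  apply/setP=> x; have /setP/(_ x) := eT.
  have : (x \in zX M T m) ==> (x \in zX M T m.+1) by apply/implyP/subsetP/zXS.
  rewrite /zS in_setU in_setI !in_setD !in_set1 /=.
  by case: (x \in T); case: (x \in zX M T m); case: (x \in _); case: (x == t).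
rewrite flag_prodS; apply: unit_leadingM (IHm (ltnW ltm)) _; last exact: unit_leading_eder.
rewrite -setI_eq0; apply/eqP/setP=> x; rewrite !in_setI !in_setD in_set0 /=.
by case: (x \in zX M T m); rewrite !andbF.
Qed.

Lemma eder_flag_prod m : (m <= #|T|)%N -> eder (flag_prod m) = 0.
Proof.
elim: m => [_|m IHm ltm]; first by rewrite /flag_prod big_geq // eder1.
rewrite flag_prodS (ederM _ (unit_leading_homog (flag_prod_leading (ltnW ltm)))).
by rewrite (IHm (ltnW ltm)) mul0r eder_eder !mulr0 addr0.
Qed.

Lemma flag_prod_supp m U p : flag_prod m U != 0 -> (p < m)%N ->
  (#|~: U :&: zS M T p.+1| <= 1)%N.
Proof.
elim: m U => // m IHm U; rewrite flag_prodS => /ext_mul_supp[A' [B [nzA nzB _ ->]]].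
rewrite ltnS leq_eqVlt => /predU1P[->|ltp].
  have [i _ ->] := eder_mono_supp nzB; rewrite -(cards1 i); apply: subset_leq_card.
  apply/subsetP=> x; rewrite in_setI in_setC in_setU in_setD1 in_set1.
  by case: (x == i) => //=; case: (x \in zS _ _ _); rewrite ?orbT ?andbF.
apply: leq_trans (IHm _ nzA ltp); apply: subset_leq_card.
by rewrite setSI // setCU subsetIl.
Qed.

Hypothesis spanT : zX M T #|T| = setT.

(** A surviving monomial would put [D] in the complement of a support set, which has at most one
    point in each block; [D] would then be independent. *)
Lemma flag_prod_dep D : dependent M D -> flag_prod #|T| * emono R D = 0.
Proof.
move=> dD; apply/ffunP=> U; rewrite [RHS]ffunE; apply/eqP.
apply: contraNT dD => /ext_mul_supp[A' [B [nzA]]]; rewrite ffunE.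
have [->|] := eqVneq B D; last by rewrite eqxx.
rewrite disjoint_sym disjoints_subset => _ sDA _.
rewrite -(setIT D) -spanT; apply: transversal_indep => p ltp.
by apply: leq_trans (flag_prod_supp nzA ltp); rewrite subset_leq_card // setSI.
Qed.

(** Apply the derivation to [flag_prod_dep]: by the Leibniz rule only this term remains, up to
    sign. *)
Lemma flag_prod_eder_dep D : dependent M D ->
  flag_prod #|T| * eder (emono R D) = 0.
Proof.
move=> dD; have h := unit_leading_homog (flag_prod_leading (leqnn #|T|)).
have := ederM (emono R D) h; rewrite flag_prod_dep // raddf0 eder_flag_prod //.
rewrite mul0r add0r => /(congr1 (fun a => (-1) ^+ #|zX M T #|T| :\: T| * a)).
by rewrite mulr0 mulrA -expr2 sqrr_sign mul1r.
Qed.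

Lemma zelt_leading : unit_leading (zelt M R T) (~: T).
Proof.
apply: unit_leading_sign; rewrite -setTD -spanT.
exact: flag_prod_leading.
Qed.

Lemma zelt_annihilator : annihilator (os_ideal M R) (zelt M R T).
Proof.
(* The factor [c] makes closure of [J] under left multiplication immediate. *)
pose J b := forall c, flag_prod #|T| * (c * b) = 0.
suff IJ b : os_ideal M R b -> J b.
  by move=> b /IJ/(_ 1); rewrite mul1r /zelt -mulrA => ->; rewrite mulr0.
apply; first split.
- by move=> c; rewrite !mulr0.
- by move=> x y Jx Jy c; rewrite !mulrDr Jx Jy addr0.
- move=> x y Jy; split=> c; first by rewrite (mulrA c) Jy.
  by rewrite (mulrA c) mulrA Jy mul0r.
move=> _ [D dD ->] c; rewrite (ext_expand c) mulr_suml mulr_sumr big1 // => U _.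
rewrite -scalerAl -scalerAr mulrA.
(* Homogeneity moves the monomial of [c] to the left up to sign, bringing the product next to the
   generator. *)
rewrite (homog_mulC _ (unit_leading_homog (flag_prod_leading (leqnn _)))).
by rewrite -scalerAl -mulrA flag_prod_eder_dep // mulr0 !scaler0.
Qed.

End FlagProduct.

End Flag.

(** * The Gröbner basis property *)

Theorem theorem3p3 (R : comNzRingType) (n l : nat) (M : matroid n)
    (M_simple : simple_matroid M) (M_rank : mrank M [set: 'I_n] = l) :
  groebner_basis
    (fun z : extalg R n => exists2 T, nbcp M l T & z = zelt M R T)
    (annihilator (os_ideal M R)).
Proof.
have leadZ T : nbcp M l T -> unit_leading (zelt M R T) (~: T).
  move=> nT; apply: (zelt_leading M_simple); first by case: nT.
  by apply: nbc_spanning => //; rewrite M_rank.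
have annZ T : nbcp M l T -> annihilator (os_ideal M R) (zelt M R T).
  move=> nT; apply: (zelt_annihilator M_simple); first by case: nT.
  by apply: nbc_spanning => //; rewrite M_rank.
split=> [_ [T nT ->]|S]; first exact: annZ.
split=> [[a [aI _ lead_a]]|[S0 [[_ [[T nT ->] _ lead0]] /emono_dvdP sS0]]].
  have nbcS : nbc M (~: S).
    move=> B [C [i [cC iC minC eB]]]; apply/negP=> sB.
    have dB : [disjoint B & ~: S :\: B] by rewrite -setI_eq0 setIDA setDIl setDv set0I.
    have uS : ~: S = B :|: (~: S :\: B) by rewrite -{1}(setID (~: S) B) (setIidPr sB).
    (* The boundary of [C] leads with the broken circuit [B]; the second factor supplies the rest of
       [~: S]. *)
    pose b := eder (emono R C) * emono R (~: S :\: B).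
    have bI : os_ideal M R b.
      have [_ _ IM] := ideal_gen_ideal (fun g => exists2 D, dependent M D & g = eder (emono R D)).
      apply: (IM _ _ _).2; move=> J _; apply; exists C => //; exact: circuit_dep.
    have lead_b : unit_leading b (~: S).
      rewrite uS; apply: unit_leadingM (unit_leading_mono _ _) => //.
      by rewrite eB; apply: unit_leading_eder.
    by case/eqP: (leading_mul_compl lead_a lead_b); apply: aI.
  have [T nT sST] := nbc_ext nbcS; rewrite M_rank in nT.
  exists (~: T); split; last by apply/emono_dvdP; rewrite -setCS setCK.
  have lT := unit_leadingP (leadZ T nT).
  exists (zelt M R T); split=> //; first by exists T.
  by move=> z0; case: lT; rewrite z0 ffunE eqxx.
have eS0 := unit_leading_uniq lead0 (leadZ T nT).
rewrite eS0 in sS0.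
(* Multiplying z(T) by the elements of [S] missing from [~: T] raises the leading set to exactly
   [S]. *)
pose a := zelt M R T * emono R (S :\: ~: T).
have lead_a : unit_leading a S.
  rewrite -(setUidPr sS0) -[in X in _ :|: X](setID S (~: T)) (setIidPr sS0) setUA setUid.
  apply: unit_leadingM (leadZ T nT) (unit_leading_mono _ _).
  by rewrite -setI_eq0 setIDA setDIl setDv set0I.
exists a; split; last exact: unit_leadingP.
  by apply: annihilatorMr (annZ T nT); apply: ideal_gen_ideal.
by move=> a0; have [] := unit_leadingP lead_a; rewrite a0 ffunE eqxx.
Qed.
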